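(* Let $m$, $n$ and $q$ be positive integers such that $mnq$ is even. Then \[ \sum_{k = 1}^\infty \frac{F_{2nk+mnq}}{\prod_{j=0}^{m} F_{nk+jnq}^2} = \frac{1}{F_{mnq}}\sum_{k=1}^{q}\frac{1}{\prod_{j=0}^{m-1}F_{nk+jnq}^2}. \]
   Context: The Fibonacci numbers are defined by $F_0=0$, $F_1=1$, $F_n=F_{n-1}+F_{n-2}$. Infinite sums are limits of partial sums. *)

(* Defs.v *)
From mathcomp Require Import all_boot.
Set Implicit Arguments.
Unset Strict Implicit.
Unset Printing Implicit Defensive.

Fixpoint fib (n : nat) : nat :=
  if n is n'.+1 then
    if n' is n''.+1 then fib n' + fib n'' else 1
  else 0.

(* Main.v *)
Require Import Defs.
From mathcomp Require Import all_boot all_order all_algebra.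
From mathcomp Require Import all_classical reals topology normedtype sequences.
From mathcomp Require Import ring zify.
Import Order.TTheory GRing.Theory Num.Theory.
Import numFieldNormedType.Exports.
Local Open Scope classical_set_scope.
Local Open Scope ring_scope.

(** Put [s = m n q].  Since [s] is even, Catalan's identity reads
    [F_(2a+s) F_s = F_(a+s)^2 - F_a^2].  With [a = n k] this makes [F_s] times
    the [k]-th term equal to [g k - g (k + q)], where
    [g k = 1 / \prod_(j < m) F_(nk+jnq)^2].  The series telescopes with step
    [q], and [g] tends to [0]. *)

Lemma fibSS (n : nat) : fib n.+2 = (fib n.+1 + fib n)%N.
Proof. by []. Qed.

Lemma fibD (a b : nat) :
  fib (a + b).+1 = (fib a.+1 * fib b.+1 + fib a * fib b)%N.
Proof.
elim/ltn_ind: b => -[|[|b]] IH.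
- by rewrite addn0 muln1 muln0 addn0.
- by rewrite addn1 fibSS !muln1.
- rewrite !addnS fibSS IH // -addnS IH // (fibSS b.+1) (fibSS b); ring.
Qed.

Lemma leq_fibS (n : nat) : (n <= (fib n).+1)%N.
Proof.
elim/ltn_ind: n => -[|[|[|[|n]]]] // IH.
have h1 := IH n.+3 (ltnSn _); have h2 := IH n.+2 (leqnSn _).
rewrite fibSS; move: h1 h2; rewrite fibSS; lia.
Qed.

Lemma fib_gt0 (n : nat) : (0 < n)%N -> (0 < fib n)%N.
Proof. by elim: n => // -[|n] // IH _; rewrite fibSS addn_gt0 IH. Qed.

Lemma fib_Cassini (R : comPzRingType) (n : nat) :
  (fib n.+1)%:R ^+ 2 - (fib n.+1)%:R * (fib n)%:R - (fib n)%:R ^+ 2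
    = (-1) ^+ n :> R.
Proof.
elim: n => [|n IH]; first by rewrite /= !expr2; ring.
by rewrite [RHS]exprS -IH fibSS natrD; ring.
Qed.

Lemma fib_Catalan_even (R : comPzRingType) (a s : nat) : ~~ odd s ->
  (fib (2 * a + s))%:R * (fib s)%:R
    = (fib (a + s))%:R ^+ 2 - (fib a)%:R ^+ 2 :> R.
Proof.
case: s => [|s] evs; first by rewrite mulr0 addn0 subrr.
have cassini : (fib s.+1 + fib s)%:R ^+ 2
    - (fib s.+1 + fib s)%:R * (fib s.+1)%:R - (fib s.+1)%:R ^+ 2 = 1 :> R.
  by rewrite -fibSS fib_Cassini -signr_odd (negbTE evs).
have fib2a : (fib (2 * a))%:R
    = (fib a)%:R * ((fib a.+1)%:R *+ 2 - (fib a)%:R) :> R.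
  case: a => [|a]; first by rewrite muln0 mul0r.
  by rewrite mul2n -addnn addSn addnS -addSn fibD !fibSS !natrD !natrM !natrD; ring.
have fib2aS : (fib (2 * a).+1)%:R = (fib a.+1)%:R ^+ 2 + (fib a)%:R ^+ 2 :> R.
  by rewrite mul2n -addnn fibD natrD !natrM.
rewrite !addnS (fibD (2 * a)) (fibD a) !natrD !natrM fib2a fib2aS.
rewrite -[X in _ = _ - X]mulr1 -[X in _ = _ - _ * X]cassini !natrD; ring.
Qed.

Lemma sum_telescope_step (V : zmodType) (g : nat -> V) (q N : nat) :
  \sum_(1 <= k < N.+1) (g k - g (k + q)%N)
    = \sum_(1 <= k < q.+1) g k - \sum_(0 <= i < q) g (N.+1 + i)%N.
Proof.
elim: N => [|N IH].
  rewrite big_nil [X in X - _]big_add1 /=.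
  by under [X in _ - X]eq_bigr do rewrite add1n; rewrite subrr.
rewrite big_nat_recr //= IH -addrA; congr (_ + _).
have <- : g N.+1 + \sum_(0 <= i < q) g (N.+2 + i)%N - g (N.+1 + q)%N
    = \sum_(0 <= i < q) g (N.+1 + i)%N.
  apply/eqP; rewrite subr_eq -big_nat_recr //= big_nat_recl //= addn0.
  by under eq_bigr do rewrite addSnnS.
by rewrite opprB addrC subrKA opprD addrA subrr add0r.
Qed.

Definition fib_sqr_prod (R : pzRingType) (n q k l : nat) : R :=
  \prod_(0 <= j < l) ((fib (n * k + j * n * q))%:R ^+ 2).

Lemma fib_term_telescope (R : numFieldType) (m n q k : nat) :
  (0 < m)%N -> (0 < n)%N -> (0 < q)%N -> (0 < k)%N -> ~~ odd (m * n * q) ->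
  let P := fib_sqr_prod R n q in
  (fib (2 * n * k + m * n * q))%:R / P k m.+1
    = (fib (m * n * q))%:R^-1 * (1 / P k m - 1 / P (k + q)%N m).
Proof.
move=> hm hn q0 k0 evs P.
have F0 i : (0 < i)%N -> (fib i)%:R != 0 :> R.
  by move=> i0; rewrite pnatr_eq0 -lt0n fib_gt0.
have P0 i l : (0 < i)%N -> P i l != 0.
  move=> i0; rewrite /P /fib_sqr_prod prodf_seq_neq0; apply/allP => j _ /=; rewrite expf_neq0 // F0 //.
  by rewrite addn_gt0 muln_gt0 hn i0.
have s0 := F0 (m * n * q)%N; rewrite !muln_gt0 hm hn q0 in s0.
have a0 : (fib (n * k))%:R != 0 :> R by rewrite F0 // muln_gt0 hn.
have as0 : (fib (n * k + m * n * q))%:R != 0 :> R.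
  by rewrite F0 // addn_gt0 muln_gt0 hn k0.
have PS : P k m.+1 = P k m * (fib (n * k + m * n * q))%:R ^+ 2.
  by rewrite /P /fib_sqr_prod big_nat_recr.
have PS' : P k m.+1 = (fib (n * k))%:R ^+ 2 * P (k + q)%N m.
  rewrite /P /fib_sqr_prod big_nat_recl // !mul0n addn0; congr (_ * _).
  apply: eq_bigr => j _; congr ((fib _)%:R ^+ 2); lia.
have -> : 1 / P k m = (fib (n * k + m * n * q))%:R ^+ 2 / P k m.+1.
  by rewrite PS; field; rewrite P0 // as0.
have -> : 1 / P (k + q)%N m = (fib (n * k))%:R ^+ 2 / P k m.+1.
  by rewrite PS'; field; rewrite P0 ?addn_gt0 ?k0 // a0.
rewrite -mulrBl -(fib_Catalan_even _ _ _ evs) mulnA.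
by field; rewrite s0 // P0.
Qed.

Lemma cvg_inv_fib_sqr_prod (R : realType) (m n q : nat) : (0 < m)%N -> (0 < n)%N ->
  (fun k => 1 / fib_sqr_prod R n q k m) @ \oo --> (0 : R).
Proof.
move=> hm hn.
rewrite -(cvg_shiftn 2).
apply: (@squeeze_cvgr _ _ _ _ (cst 0) (@harmonic R)); last 2 first.
- exact: cvg_cst.
- exact: cvg_harmonic.
near=> k; apply/andP; split; rewrite /= div1r.
  by rewrite invr_ge0 /fib_sqr_prod prodr_ge0 // => j _; rewrite exprn_ge0.
have Fk j : (k < fib (n * (k + 2) + j))%N.
  by have := leq_fibS (n * (k + 2) + j); nia.
have P1 l (j0 : nat) : 1 <= \prod_(j0 <= j < l)
    ((fib (n * (k + 2) + j * n * q))%:R ^+ 2) :> R.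
  elim/big_ind: _ => // [x y x1 y1|j _]; first by rewrite mulr_ege1.
  by rewrite exprn_ege1 // ler1n (leq_trans _ (Fk _)).
rewrite /harmonic lef_pV2 ?posrE ?ltr0n //; last first.
  by rewrite (lt_le_trans _ (P1 _ _)).
rewrite /fib_sqr_prod big_ltn // -[leLHS]mulr1 ler_pM // -natrX ler_nat.
by have := Fk (0 * n * q)%N; rewrite -mulnn; nia.
Unshelve. all: by end_near.
Qed.

Theorem theorem2p36 (R : realType) (m n q : nat)
    (hm : (0 < m)%N) (hn : (0 < n)%N) (hq : (0 < q)%N)
    (heven : ~~ odd (m * n * q)%N) :
  (fun N : nat => \sum_(1 <= k < N.+1)
      (fib (2 * n * k + m * n * q))%:R
        / \prod_(0 <= j < m.+1) ((fib (n * k + j * n * q))%:R ^+ 2 : R))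
    @ \oo -->
  1 / (fib (m * n * q))%:R
    * \sum_(1 <= k < q.+1)
        1 / \prod_(0 <= j < m) ((fib (n * k + j * n * q))%:R ^+ 2 : R).
Proof.
pose g k := 1 / fib_sqr_prod R n q k m.
have g0 : g @ \oo --> (0 : R) by exact: cvg_inv_fib_sqr_prod.
have -> : (fun N : nat => \sum_(1 <= k < N.+1)
      (fib (2 * n * k + m * n * q))%:R
        / \prod_(0 <= j < m.+1) ((fib (n * k + j * n * q))%:R ^+ 2 : R))
  = fun N => (fib (m * n * q))%:R^-1 *
      (\sum_(1 <= k < q.+1) g k - \sum_(0 <= i < q) g (N.+1 + i)%N).
  apply/funext => N; rewrite -sum_telescope_step mulr_sumr.
  by apply: eq_big_nat => k /andP[k0 _]; rewrite [LHS]fib_term_telescope.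
rewrite div1r -[X in _ * X]subr0.
apply: cvgMl_tmp; apply: cvgB; first exact: cvg_cst.
rewrite [X in _ --> X](_ : 0 = \sum_(0 <= i < q) 0); last by rewrite big1.
apply: cvg_big => [|i _]; first exact: add_continuous.
under eq_fun do rewrite addSnnS.
by have := g0; rewrite -(cvg_shiftn i.+1).
Qed.
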